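(* Let $G$ be a Lichnerowicz-sharp graph, and let $H$ be a connected component of $G_{\mathrm{vis}}$. Then $\hat G$ is (isomorphic to) an $H$-bundle over $G'$, and this bundle admits a section. Moreover, if $G'$ is not a singleton graph, then $G'$ also satisfies $\mathrm{CD}(2,\infty)$, and $\lambda_1(G')>2$.
   Context: All graphs are finite, simple and unweighted; $G=(V,E)$ is connected. The (non-normalized) Laplacian is $Lh(x)=\sum_{y\sim x}(h(y)-h(x))$; the eigenvalues of $-L$ are $0=\lambda_0<\lambda_1\le\lambda_2\le\cdots$ with multiplicity. For functions $f,g:V\to\mathbb R$, $\Gamma(f,g)(x)=\frac12\sum_{y\sim x}(f(y)-f(x))(g(y)-g(x))$, $\Gamma_2(f,g)=\frac12(L\Gamma(f,g)-\Gamma(g,Lf)-\Gamma(f,Lg))$, $\Gamma(f)=\Gamma(f,f)$, $\Gamma_2(f)=\Gamma_2(f,f)$. $G$ satisfies $\mathrm{CD}(K,\infty)$ if $\Gamma_2(f)(x)\ge K\,\Gamma(f)(x)$ for all $f:V\to\mathbb R$ and all $x\in V$. $G$ is Lichnerowicz-sharp if for some $K>0$ it satisfies $\mathrm{CD}(K,\infty)$ and $\lambda_1(G)=K$ (by a known earlier theorem, then necessarily $K=2$). Put $E_2(G)=\ker(L+2I)$. An edge $xy$ of $G$ is visible if some $a\in E_2(G)$ has $a(x)\ne a(y)$, and collapsed otherwise. $G_{\mathrm{vis}}$ is the spanning subgraph of $G$ whose edges are the visible edges. $G'$ is the graph whose vertices are the connected components of $G_{\mathrm{vis}}$, two distinct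 components being adjacent iff some edge of $G$ joins them. $\hat G$ is obtained from $G$ by deleting precisely the collapsed edges whose two endpoints lie in the same connected component of $G_{\mathrm{vis}}$. Graph bundle: let $B,F$ be graphs and let $\sigma$ assign to each oriented edge $(x,y)$ of $B$ an automorphism $\sigma_{xy}\in\mathrm{Aut}(F)$ with $\sigma_{yx}=\sigma_{xy}^{-1}$. $B\square_\sigma F$ has vertex set $V(B)\times V(F)$ and edges $(x,u)\sim(y,\sigma_{xy}(u))$ whenever $x\sim y$ in $B$, and $(x,u)\sim(x,v)$ whenever $u\sim v$ in $F$. It is called an $F$-bundle over $B$. A section of $B\square_\sigma F$ is a graph homomorphism $s:B\to B\square_\sigma F$ such that $\pi_1\circ s=\mathrm{id}_{V(B)}$, where $\pi_1(x,u)=x$. *)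

(* Defs.v *)
From HB Require Import structures.
From mathcomp Require Import all_boot all_order all_algebra all_fingroup.
From mathcomp Require Import boolp reals.
From mathcomp Require Import polyrcf.

Set Implicit Arguments.
Unset Strict Implicit.
Unset Printing Implicit Defensive.

Import Order.TTheory GRing.Theory Num.Theory.
Local Open Scope ring_scope.

Record sgraph := SGraph {
  svertex :> finType;
  edge : rel svertex;
  edge_sym : symmetric edge;
  edge_irrefl : irreflexive edge }.

Definition graph_connected (G : sgraph) : Prop :=
  (0 < #|G|)%N /\ forall x y : G, connect (@edge G) x y.

(* Vertex sets of the connected components. *)
Definition components (G : sgraph) : {set {set G}} :=
  equivalence_partition (connect (@edge G)) [set: G].

Definition graph_hom (G1 G2 : sgraph) (f : G1 -> G2) : Prop :=
  forall x y : G1, edge x y -> edge (f x) (f y).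

Definition graph_iso (G1 G2 : sgraph) : Prop :=
  exists f : G1 -> G2,
    bijective f /\ forall x y : G1, edge (f x) (f y) = edge x y.

Section Induced.
Variables (G : sgraph) (A : {set G}).

Definition induced_edge : rel {x : G | x \in A} :=
  fun u v => edge (val u) (val v).

Lemma induced_edge_sym : symmetric induced_edge.
Proof. by move=> u v; rewrite /induced_edge edge_sym. Qed.

Lemma induced_edge_irrefl : irreflexive induced_edge.
Proof. by move=> u; rewrite /induced_edge edge_irrefl. Qed.

Definition induced : sgraph := SGraph induced_edge_sym induced_edge_irrefl.
End Induced.

Section Curvature.
Variables (R : realType) (G : sgraph).

Definition Lap (h : G -> R) : G -> R :=
  fun x => \sum_(y | edge x y) (h y - h x).

Definition Gam (f g : G -> R) : G -> R :=
  fun x => 2^-1 * \sum_(y | edge x y) (f y - f x) * (g y - g x).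

Definition Gam2 (f g : G -> R) : G -> R :=
  fun x => 2^-1 * (Lap (Gam f g) x - Gam g (Lap f) x - Gam f (Lap g) x).

Definition CD (K : R) : Prop :=
  forall (f : G -> R) (x : G), K * Gam f f x <= Gam2 f f x.

(* The matrix of -L in the basis of indicator functions, in MathComp's
   row-vector convention: row i is the image of the i-th indicator. *)
Definition neg_Lap_mx : 'M[R]_#|G| :=
  \matrix_(i, j) - Lap (fun z => (z == enum_val i)%:R) (enum_val j).

(* [rootsR] lists the distinct real roots in increasing order; each eigenvalue
   is repeated according to the dimension of its eigenspace. *)
Definition eigenvalues : seq R :=
  flatten [seq nseq (\rank (eigenspace neg_Lap_mx l)) l
          | l <- rootsR (char_poly neg_Lap_mx)].

(* Indexed from 0, so that [lambda 0 = 0]; the value is the junk 0 when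
   [#|G| <= k], in particular for [lambda 1] of a singleton. *)
Definition lambda (k : nat) : R := nth 0 eigenvalues k.

Definition lichnerowicz_sharp : Prop :=
  exists K : R, [/\ 0 < K, CD K & lambda 1 = K].

Definition E2 (a : G -> R) : Prop := forall x : G, Lap a x + 2 * a x = 0.

Definition visible : rel G := fun x y =>
  edge x y && `[< exists a : G -> R, E2 a /\ a x <> a y >].

Definition collapsed : rel G := fun x y => edge x y && ~~ visible x y.

Lemma visible_sym : symmetric visible.
Proof.
move=> x y; rewrite /visible edge_sym; congr (_ && _).
by apply/asboolP/asboolP => -[a [ha hne]]; exists a; split => // /esym.
Qed.

Lemma visible_irrefl : irreflexive visible.
Proof. by move=> x; rewrite /visible edge_irrefl. Qed.

Definition Gvis : sgraph := SGraph visible_sym visible_irrefl.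

(* The graph G' of components of [Gvis]. *)
Definition quot_edge : rel {C : {set G} | C \in components Gvis} :=
  fun C D => (C != D) &&
    [exists x : G, exists y : G, [&& x \in val C, y \in val D & edge x y]].

Lemma quot_edge_sym : symmetric quot_edge.
Proof.
suff imp C D : quot_edge C D -> quot_edge D C.
  by move=> C D; apply/idP/idP; apply: imp.
move=> /andP[neq /existsP[x /existsP[y /and3P[xC yD xy]]]].
rewrite /quot_edge eq_sym neq; apply/existsP; exists y; apply/existsP; exists x.
by rewrite yD xC edge_sym.
Qed.

Lemma quot_edge_irrefl : irreflexive quot_edge.
Proof. by move=> C; rewrite /quot_edge eqxx. Qed.

Definition Gquot : sgraph := SGraph quot_edge_sym quot_edge_irrefl.

Definition hat_edge : rel G := fun x y =>
  edge x y && ~~ (collapsed x y && connect (@edge Gvis) x y).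

Lemma hat_edge_sym : symmetric hat_edge.
Proof.
move=> x y; rewrite /hat_edge /collapsed edge_sym visible_sym.
by rewrite (sym_connect_sym (@edge_sym Gvis)).
Qed.

Lemma hat_edge_irrefl : irreflexive hat_edge.
Proof. by move=> x; rewrite /hat_edge edge_irrefl. Qed.

Definition Ghat : sgraph := SGraph hat_edge_sym hat_edge_irrefl.

End Curvature.

(* Only the values of [sigma] on oriented edges of B matter. *)
Record bundle_data (B F : sgraph) := BundleData {
  sigma :> B -> B -> {perm F};
  sigma_aut : forall x y : B, edge x y ->
    forall u v : F, edge (sigma x y u) (sigma x y v) = edge u v;
  sigma_inv : forall x y : B, edge x y -> sigma y x = ((sigma x y)^-1)%g }.

Section Bundle.
Variables (B F : sgraph) (s : bundle_data B F).

Definition bundle_edge : rel (B * F)%type := fun p q =>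
  (edge p.1 q.1 && (q.2 == s p.1 q.1 p.2)) ||
  ((p.1 == q.1) && edge p.2 q.2).

Lemma bundle_edge_sym : symmetric bundle_edge.
Proof.
move=> [x u] [y v]; rewrite /bundle_edge /= (edge_sym u) (eq_sym x).
congr (_ || _); rewrite [edge y x]edge_sym.
case xy: (edge x y) => //=; rewrite (sigma_inv s xy).
by apply/eqP/eqP => ->; rewrite ?permK ?permKV.
Qed.

Lemma bundle_edge_irrefl : irreflexive bundle_edge.
Proof. by move=> [x u]; rewrite /bundle_edge /= !edge_irrefl andbF. Qed.

Definition bundle : sgraph := SGraph bundle_edge_sym bundle_edge_irrefl.

Definition is_section (t : B -> bundle) : Prop :=
  graph_hom t /\ forall x : B, (t x).1 = x.

End Bundle.

(* Main.v *)
Require Import Defs.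
From mathcomp Require Import all_boot all_order all_algebra all_fingroup.
From mathcomp Require Import boolp reals.
From mathcomp Require Import ring lra.
From mathcomp Require Import polyrcf complex.

Set Implicit Arguments.
Unset Strict Implicit.
Unset Printing Implicit Defensive.

Import Order.TTheory GRing.Theory Num.Theory.
Local Open Scope ring_scope.

(** Sharpness makes the polar form of [Gam2 - K * Gam] vanish against an
    eigenfunction [f], and testing it on indicator functions gives [K = 2] and a
    balance law: for [x <> z] that are non-adjacent or at the same level of [f],
    the sum over common neighbors [w] of [f x + f z - 2 * f w] is zero.  Choose
    [f] in E_2 separating the endpoints of every visible edge.  By downward
    induction on the level, the balance law shows that all ascending walks of [f]
    from a vertex end at the same peak, and that a vertex has at most one
    neighbor in each other sheet (a sheet being the set of vertices with a given
    peak).  The sheets are the components of G_vis.  Transporting along visible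
    edges, two sheets joined by an edge are matched by an isomorphism that
    preserves [f], hence the peaks: these matchings are the bundle structure and
    the peaks are the section.  Functions on G' lift to G compatibly with [Lap]
    and [Gam], which yields the curvature bound, and an eigenfunction of G' for
    the eigenvalue 2 would lift to an element of E_2 separating two components. *)

(** * Signs of the terms of a vanishing finite sum *)

Section ZeroSums.
Variables (R : realFieldType) (I : finType) (P : pred I) (F : I -> R).
Hypothesis sumF : \sum_(k | P k) F k = 0.

(** Otherwise all products [F j * F i] would be nonnegative with sum zero, forcing [F i ^+ 2 = 0].
    In the balance law this yields a second common neighbor, on the other side of the mean level. *)
Lemma sum0_opposite i : P i -> F i != 0 -> exists2 j, P j & F j * F i < 0.
Proof.
move=> Pi Fi; have [/existsP[j /andP[Pj Fj]]|] :=
  boolP [exists j, P j && (F j * F i < 0)]; first by exists j.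
move/existsPn => none.
have nonneg j : P j -> 0 <= F j * F i.
  by move=> Pj; move: (none j); rewrite Pj /= -leNgt.
have sum0 : \sum_(k | P k) F k * F i = 0 by rewrite -mulr_suml sumF mul0r.
move/eqP: sum0; rewrite psumr_eq0 // => /allP /(_ i (mem_index_enum i)).
by rewrite Pi /= mulf_eq0 orbb (negbTE Fi).
Qed.

(** Only the term at [j] may be negative, so dropping the other terms can only decrease the sum.
    This serves to refute configurations with a single negative common neighbor. *)
Lemma sum0_pair_le0 i j : P i -> P j -> i != j ->
  (forall k, P k -> k != j -> 0 <= F k) -> F i + F j <= 0.
Proof.
move=> Pi Pj neq nonneg; rewrite -sumF (bigD1 i) //= (bigD1 j) /=; last first.
  by rewrite Pj eq_sym.
rewrite addrA lerDl; apply: sumr_ge0 => k /andP[/andP[Pk _] kj].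
exact: nonneg.
Qed.

Lemma sum0_triple_le0 i i' j : P i -> P i' -> P j -> i != i' -> i != j ->
  i' != j -> (forall k, P k -> k != j -> 0 <= F k) -> F i + F i' + F j <= 0.
Proof.
move=> Pi Pi' Pj neq neqi neqi' nonneg.
rewrite -sumF (bigD1 i) //= (bigD1 i') /= ?Pi' 1?eq_sym //.
rewrite (bigD1 j) /= ?Pj 1?[j == _]eq_sym ?neqi 1?eq_sym // !addrA lerDl.
by apply: sumr_ge0 => k /andP[/andP[/andP[Pk _] _] kj]; exact: nonneg.
Qed.

End ZeroSums.

(** * Ascents of a balanced function *)

Section Sheets.
Variables (R : realFieldType) (T : finType) (e : rel T) (f : T -> R).

Definition balanced : Prop := forall x z, x != z -> ~~ e x z || (f x == f z) ->
  \sum_(w | e x w && e z w) (f x + f z - 2 * f w) = 0.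

Definition ascent : rel T := fun x y => e x y && (f x < f y).

Definition peak x := [forall y, ~~ ascent x y].

(* [pi] follows ascents to a peak. *)
Definition summit_map (pi : T -> T) : Prop := forall x,
  [/\ peak (pi x), peak x -> pi x = x &
      ~~ peak x -> exists2 y, ascent x y & pi x = pi y].

Definition climb x := odflt x [pick y | ascent x y].

Lemma climbP x : if peak x then climb x = x else ascent x (climb x).
Proof.
rewrite /climb /peak; case: pickP => [y xy|none] /=.
  by case: forallP => // /(_ y); rewrite xy.
by case: forallP => // -[] y; rewrite none.
Qed.

(** An integer rank in place of the real level: it drops along ascents and serves as induction
    measure. *)
Definition height x := #|[set y | f x < f y]|.

Lemma height_lt x y : f x < f y -> (height y < height x)%N.
Proof.
move=> xy; apply: proper_card; apply/properP; split.
  by apply/subsetP => z; rewrite !inE; apply: lt_trans.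
by exists y; rewrite !inE ?ltxx.
Qed.

Lemma exists_summit_map : exists pi, summit_map pi.
Proof.
have stay n x : peak x -> iter n climb x = x.
  by move=> px; elim: n => //= n ->; have := climbP x; rewrite px.
have top n x : (height x <= n)%N -> peak (iter n climb x).
  elim: n x => [|n IHn] x hx.
    apply/forallP => y; apply/negP => /andP[_ /height_lt].
    by rewrite ltnNge (leq_trans hx).
  have := climbP x; case: ifP => [px _|_ /andP[_ /height_lt xc]].
    by rewrite stay.
  by rewrite iterSr; apply: IHn; rewrite -ltnS (leq_trans xc).
have heightT x : (height x <= #|T|)%N by exact: max_card.
exists (iter #|T| climb) => x; split=> [||npx].
- exact: top.
- exact: stay.
- have := climbP x; rewrite (negbTE npx) => xc; exists (climb x) => //.
  (* [#|T|] steps already reach a peak, so one further climb changes nothing. *)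
  rewrite -iterSr iterS; have := climbP (iter #|T| climb x).
  by rewrite top // => ->.
Qed.

Hypothesis e_sym : symmetric e.
Hypothesis bal : balanced.
Variable pi : T -> T.
Hypothesis piP : summit_map pi.

Definition confluent x := forall y, ascent x y -> pi x = pi y.

Definition single_level x := forall u1 u2, e x u1 -> e x u2 ->
  f u1 = f x -> f u2 = f x -> pi u1 = pi u2 -> pi u1 <> pi x -> u1 = u2.

Lemma ascent_neq x y : f x < f y -> x != y.
Proof. by apply: contraTneq => ->; rewrite ltxx. Qed.

(** Suppose [x] ascends to [y1] and [y2] with different peaks and [f y1 <= f y2]. In the balance law
    for this pair, the positive term at [x] forces a common neighbor [w] with negative term.
    Confluence higher up puts [w] in the sheet of [y1] and at the level of [y2], and [single_level]
    at [y2] makes it the only one. The terms at [x] and [w] then add up to [2 * (f y1 - f x) > 0],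
    which is impossible. *)
Lemma confluent_step x :
  (forall y, f x < f y -> confluent y) ->
  (forall y, f x < f y -> single_level y) -> confluent x.
Proof.
move=> confl single.
suff same y1 y2 : ascent x y1 -> ascent x y2 -> f y1 <= f y2 -> pi y1 = pi y2.
  move=> y xy; have [_ _ [|z xz ->]] := piP x.
    by apply/forallPn; exists y; rewrite negbK.
  by case: (leP (f z) (f y)) => [/same -> // | /ltW /same <-].
move=> /andP[xy1 lt1] /andP[xy2 lt2] le12; apply/eqP/negPn/negP => neq.
have y12 : y1 != y2 by apply: contraNneq neq => ->.
have flat : ~~ e y1 y2 || (f y1 == f y2).
  rewrite -implybE; apply/implyP => e12; move: le12; rewrite le_eqVlt.
  case/orP => // lt12; case/eqP: neq; apply: (confl _ lt1).
  by rewrite /ascent e12.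
have sum0 := bal y12 flat.
have Px : e y1 x && e y2 x by rewrite ![e _ x]e_sym xy1.
have neg k : e y1 k && e y2 k -> f y1 + f y2 - 2 * f k < 0 ->
    f k = f y2 /\ pi y1 = pi k.
  case/andP => e1k e2k negk; have lt1k : f y1 < f k by lra.
  have pik : pi y1 = pi k by apply: (confl _ lt1); rewrite /ascent e1k.
  split=> //; case: (ltgtP (f k) (f y2)) => // lt2k; case/eqP: neq.
    rewrite pik; apply: (confl _ (lt_trans lt1 lt1k)).
    by rewrite /ascent e_sym e2k.
  by rewrite pik; symmetry; apply: (confl _ lt2); rewrite /ascent e2k.
have [|w Pw] := sum0_opposite sum0 Px; first by rewrite gt_eqF //; lra.
rewrite pmulr_llt0 => [negw|]; last by lra.
have [fw piw] := neg w Pw negw.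
have := sum0_pair_le0 sum0 Px Pw.
have [e1w e2w] := andP Pw.
have -> : x != w by apply: ascent_neq; lra.
move=> /(_ isT); suff uniq k : e y1 k && e y2 k -> k != w ->
    0 <= f y1 + f y2 - 2 * f k by move/(_ uniq); rewrite fw; lra.
move=> Pk; apply: contraNle => negk; have [fk pik] := neg k Pk negk.
have [e1k e2k] := andP Pk.
apply/eqP; apply: (single _ lt2) => //; first by rewrite -pik piw.
by rewrite -pik; apply/eqP.
Qed.

(** At a peak [v], neighbors at its level in other sheets are peaks too, so equal peaks mean equal
    vertices. Otherwise let [v] ascend to [y]: then [u1] and [u2] share a neighbor [w] at the level
    of [y]. If [u1] and [u2] differed, the terms at [u1], [u2], [y] in the balance law for [w] and
    [v] would add up to [f y - f v > 0], although only the term at [y] is negative. *)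
Lemma single_level_step v :
  (forall y, f v <= f y -> confluent y) ->
  (forall y, f v < f y -> single_level y) -> single_level v.
Proof.
move=> confl single u1 u2 e1 e2 f1 f2 pi12 piv.
have cross a b : f v <= f a -> e a b -> f a < f b -> pi a = pi b.
  by move=> le_va ab lt_ab; apply: (confl _ le_va); rewrite /ascent ab.
apply/eqP/negPn/negP => u12.
have [pv|] := boolP (peak v).
  have top u : e v u -> f u = f v -> pi u <> pi v -> pi u = u.
    move=> eu fu piu; have [_ -> //] := piP u.
    apply/forallP => w; apply/negP => /andP[uw lt_uw].
    have nvw : ~~ e w v.
      apply/negP => wv; move/forallP: pv => /(_ w).
      by rewrite /ascent e_sym wv -fu lt_uw.
    have wv : w != v by apply: contraTneq lt_uw => ->; rewrite fu ltxx.
    have Pu : e w u && e v u by rewrite e_sym uw.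
    have flat : ~~ e w v || (f w == f v) by rewrite nvw.
    have [|k] := sum0_opposite (bal wv flat) Pu; first by rewrite gt_eqF //; lra.
    case/andP => wk vk; rewrite pmulr_llt0 => [negk|]; last by lra.
    move/forallP: pv => /(_ k); rewrite /ascent vk /=; case/negP; lra.
  by case/eqP: u12; rewrite -(top u1) // -(top u2) // -?pi12.
case/forallPn => y; rewrite negbK => /andP[vy lt_vy].
have piy : pi v = pi y by apply: cross.
(* The ascent from [v] to [y] is copied into the sheet of [u] by balancing [y] against [u]. *)
have partner u : e v u -> f u = f v -> pi u <> pi v ->
    exists w, [/\ e y w, e u w, f w = f y & pi w = pi u].
  move=> eu fu piu.
  have nyu : ~~ e y u.
    apply/negP => yu; case: piu; rewrite piy; apply: cross; rewrite ?fu //.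
    by rewrite e_sym.
  have yu : y != u by apply: contraTneq lt_vy => ->; rewrite fu ltxx.
  have Pv : e y v && e u v by rewrite e_sym vy e_sym.
  have flat : ~~ e y u || (f y == f u) by rewrite nyu.
  have [|w] := sum0_opposite (bal yu flat) Pv; first by rewrite gt_eqF //; lra.
  case/andP => yw uw; rewrite pmulr_llt0 => [negw|]; last by lra.
  have piw : pi u = pi w by apply: cross => //; lra.
  exists w; split=> //; case: (ltgtP (f w) (f y)) => // lt_wy; case: piu.
    by rewrite piw piy; apply: cross; rewrite // 1?e_sym //; lra.
  by rewrite piw piy; symmetry; apply: cross; rewrite // ltW.
have piu2 : pi u2 <> pi v by rewrite -pi12.
have [w [yw uw1 fw piw]] := partner u1 e1 f1 piv.
have [w' [yw' uw2 fw' piw']] := partner u2 e2 f2 piu2.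
have ww' : w = w'.
  by apply: (single _ lt_vy) => //; rewrite ?piw' ?piw // -piy.
subst w'.
have nwv : ~~ e w v.
  apply/negP => wv; apply: piv; rewrite -piw; symmetry.
  by apply: cross; rewrite // ?fw 1?e_sym.
have wv : w != v by rewrite eq_sym; apply: ascent_neq; rewrite fw.
have flat : ~~ e w v || (f w == f v) by rewrite nwv.
have := @sum0_triple_le0 _ _ _ _ (bal wv flat) u1 u2 y.
rewrite e1 e2 vy ![e w _]e_sym uw1 uw2 yw u12.
rewrite !ascent_neq ?f1 ?f2 // fw => /(_ isT isT isT isT isT isT).
suff nonneg k : e w k && e v k -> k != y -> 0 <= f y + f v - 2 * f k.
  by move/(_ nonneg); lra.
case/andP => wk vk; apply: contraNle => negk.
have pik : pi v = pi k by apply: cross => //; lra.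
have fk : f k = f w.
  case: (ltgtP (f k) (f w)) => // lt_kw; case: piv; rewrite -piw pik.
    by symmetry; apply: cross; rewrite // 1?e_sym //; lra.
  by apply: cross; rewrite // fw ltW.
apply/eqP; apply: (single w); rewrite ?fw // 1?e_sym //.
  by rewrite -fw.
  by rewrite -pik piy.
by rewrite -pik piw => /esym.
Qed.

(** Induction on [height], that is, downward on levels. Within one level confluence comes first,
    because [single_level_step] uses it at the level of [v] itself. *)
Lemma confluent_single_level x : confluent x /\ single_level x.
Proof.
suff all n y : height y = n -> confluent y /\ single_level y by exact: all.
elim/ltn_ind: n y => n IHn.
have above y z : height y = n -> f y < f z -> confluent z /\ single_level z.
  by move=> yn /height_lt; rewrite yn => /IHn; apply.
have confl y : height y = n -> confluent y.
  by move=> yn; apply: confluent_step => z /(above _ _ yn)[].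
move=> y yn; split; first exact: confl.
apply: single_level_step => z; last by move/(above _ _ yn) => [].
rewrite le_eqVlt => /predU1P[fz|/(above _ _ yn)[] //].
by apply: confl; rewrite -yn /height fz.
Qed.

End Sheets.

(** * Isomorphisms between sheets *)

Section SheetIsomorphisms.
Variables (R : realFieldType) (T : finType) (e : rel T) (f : T -> R).
Hypothesis e_sym : symmetric e.
Hypothesis bal : balanced e f.
Variable pi : T -> T.
Hypothesis piP : summit_map e f pi.

Definition slope : rel T := fun x y => e x y && (f x != f y).

Lemma slope_sym : symmetric slope.
Proof. by move=> x y; rewrite /slope e_sym eq_sym. Qed.

Lemma ascent_slope x y : ascent e f x y -> slope x y.
Proof. by case/andP => xy lt_xy; rewrite /slope xy lt_eqF. Qed.

Lemma summit_ascent x y : ascent e f x y -> pi x = pi y.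
Proof. by have [+ _] := confluent_single_level e_sym bal piP x; apply. Qed.

Lemma summit_slope x y : slope x y -> pi x = pi y.
Proof.
case/andP => xy; rewrite neq_lt => /orP[] lt_xy; last symmetry;
  by apply: summit_ascent; rewrite /ascent lt_xy ?xy // e_sym xy.
Qed.

Lemma cross_level x y : e x y -> pi x <> pi y -> f x = f y.
Proof.
move=> xy npi; apply/eqP/negPn/negP => nf; apply: npi.
by apply: summit_slope; rewrite /slope xy.
Qed.

Lemma peak_summit x : peak e f (pi x).
Proof. by case: (piP x). Qed.

Lemma summit_peak x : peak e f x -> pi x = x.
Proof. by case: (piP x). Qed.

Lemma summitK x : pi (pi x) = pi x.
Proof. exact/summit_peak/peak_summit. Qed.

Lemma connect_summit x : connect slope x (pi x).
Proof.
have [n le_n] := ubnP (height f x); elim: n x le_n => // n IHn x le_n.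
have [px|npx] := boolP (peak e f x); first by rewrite summit_peak.
have [_ _ /(_ npx)[y xy ->]] := piP x.
apply: connect_trans (connect1 (ascent_slope xy)) (IHn _ _).
by case/andP: xy => _ /height_lt /leq_trans; apply.
Qed.

(** Slopes keep the peak, and ascents link each vertex to its peak. *)
Lemma connect_slopeE x y : connect slope x y = (pi x == pi y).
Proof.
apply/idP/eqP => [/connectP[p]|eq_pi].
  elim: p x => [|z p IHp] x /=; first by move=> _ ->.
  by case/andP => /summit_slope-> zp lp; apply: IHp.
apply: connect_trans (connect_summit x) _.
by rewrite eq_pi (sym_connect_sym slope_sym) connect_summit.
Qed.

Lemma cross_uniq v u1 u2 :
  e v u1 -> e v u2 -> pi u1 = pi u2 -> pi u1 <> pi v -> u1 = u2.
Proof.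
move=> e1 e2 pi12 piv; have [_] := confluent_single_level e_sym bal piP v.
apply=> //; apply/esym/cross_level => // /esym; rewrite -?pi12 //.
Qed.

(** Edges between sheets are level, so [y] and [u] are non-adjacent and balanced. The term at [v] is
    [f y - f v], hence nonzero, and some common neighbor [w] has a term of opposite sign. Outside
    the sheet of [u] it would be level with [u] and have the same term as [v]. *)
Lemma cross_transport v y u : slope v y -> e v u -> pi u <> pi v ->
  exists2 w, e y w & pi w = pi u /\ slope u w.
Proof.
move=> vy vu npi; have piy := summit_slope vy; case/andP: vy => vy nf.
have fu : f v = f u by apply: cross_level => // /esym.
have nyu : ~~ e y u.
  apply/negP => yu; case/eqP: nf; rewrite fu; apply/esym/cross_level => //.
  by rewrite -piy => /esym.
have yu : y != u by apply: contraNneq nf => ->; rewrite fu.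
have flat : ~~ e y u || (f y == f u) by rewrite nyu.
have Pv : e y v && e u v by rewrite ![e _ v]e_sym vy.
have [|w] := sum0_opposite (bal yu flat) Pv.
  by apply: contraNneq nf; rewrite -fu => /eqP eq0; apply/eqP; lra.
case/andP => yw uw neg; exists w => //.
have piw : pi w = pi u.
  apply/eqP/negPn/negP => /eqP nwu.
  have fuw : f u = f w by apply: cross_level => // /esym.
  by move: neg; rewrite -fuw fu -expr2 ltNge sqr_ge0.
split=> //; rewrite /slope uw /=.
have fyw : f y = f w by apply: cross_level; rewrite // piw -piy => /esym.
by rewrite -fyw -fu.
Qed.

(** The crossing edge is moved from [x] to [y] along a path of slopes, one [cross_transport] per
    step. *)
Lemma cross_exists x z y : e x z -> pi x <> pi z -> pi y = pi x ->
  exists2 w, e y w & pi w = pi z.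
Proof.
move=> xz npi /esym/eqP; rewrite -connect_slopeE => /connectP[p].
elim: p x z xz npi => [|v p IHp] x z xz npi /=; first by move=> _ ->; exists z.
case/andP => xv vp lp; have [|w vw [pw _]] := cross_transport xv xz.
  exact/nesym.
have [|w' yw' pw'] := IHp v w vw _ vp lp; last by exists w'; rewrite // pw'.
by rewrite -(summit_slope xv) pw.
Qed.

(* [th] and [th'] are mutually inverse level-preserving isomorphisms, for the
   slope relation, between the fibers of [pi] over [a] and over [b]. *)
Definition sheet_morph a b (th th' : T -> T) : Prop :=
  (forall y, pi y = a -> [/\ pi (th y) = b, th' (th y) = y & f (th y) = f y]) /\
  (forall y y', pi y = a -> slope y y' -> slope (th y) (th y')).

Definition sheet_iso a b th th' : Prop :=
  sheet_morph a b th th' /\ sheet_morph b a th' th.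

Lemma sheet_iso_id a : sheet_iso a a id id.
Proof. by split; split. Qed.

Lemma sheet_iso_sym a b th th' : sheet_iso a b th th' -> sheet_iso b a th' th.
Proof. by case. Qed.

Lemma sheet_iso_comp a b c th th' ph ph' :
  sheet_iso a b th th' -> sheet_iso b c ph ph' ->
  sheet_iso a c (ph \o th) (th' \o ph').
Proof.
have comp a1 b1 c1 th1 th1' ph1 ph1' :
    sheet_morph a1 b1 th1 th1' -> sheet_morph b1 c1 ph1 ph1' ->
    sheet_morph a1 c1 (ph1 \o th1) (th1' \o ph1').
  move=> [th1P th1s] [ph1P ph1s]; split=> [y ya|y y' ya yy'] /=.
    have [pb thK fth] := th1P y ya; have [pc phK fph] := ph1P _ pb.
    by rewrite phK fph.
  have [pb _ _] := th1P y ya.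
  exact/ph1s/th1s.
move=> [th1 th2] [ph1 ph2]; split; first exact: comp th1 ph1.
exact: comp ph2 th2.
Qed.

Lemma sheet_iso_slope a b th th' y y' : sheet_iso a b th th' ->
  pi y = a -> pi y' = a -> slope (th y) (th y') = slope y y'.
Proof.
move=> [[thP ths] [_ ths']] ya ya'; apply/idP/idP; last exact: ths.
have [pb thK _] := thP y ya; have [pb' thK' _] := thP y' ya'.
by move/(ths' _ _ pb); rewrite thK thK'.
Qed.

(** An ascent from [th a] would be carried back by [th'] to an ascent from the peak [a]. *)
Lemma sheet_iso_peak a b th th' : sheet_iso a b th th' -> pi a = a ->
  th a = b.
Proof.
move=> [[thP _] [thP' ths']] pa; have [pb thK fth] := thP a pa.
rewrite -pb; apply/esym/summit_peak/forallP => w; apply/negP => up.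
have := ths' _ _ pb (ascent_slope up); rewrite thK => /andP[aw _].
have [_ _ fw] : [/\ pi (th' w) = a, th (th' w) = w & f (th' w) = f w].
  by apply: thP'; rewrite -(summit_ascent up).
have := peak_summit a; rewrite pa => /forallP/(_ (th' w)).
by rewrite /ascent aw fw -fth; case/andP: up => _ ->.
Qed.

(* The neighbor of [y] in the fiber over [c], unique when it exists and [y] is
   outside that fiber; the junk value [y] if there is none. *)
Definition hop c y := odflt y [pick w | e y w && (pi w == c)].

Lemma hopE c y w : e y w -> pi w = c -> pi y <> c -> hop c y = w.
Proof.
move=> yw pw py; rewrite /hop; case: pickP => [u /andP[yu /eqP pu]|/(_ w)] /=.
  by apply: (cross_uniq yu yw); rewrite pu ?pw // => /esym.
by rewrite yw pw eqxx.
Qed.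

Lemma hopP x z y : e x z -> pi x <> pi z -> pi y = pi x ->
  e y (hop (pi z) y) /\ pi (hop (pi z) y) = pi z.
Proof.
move=> xz npi py; have [w yw pw] := cross_exists xz npi py.
by rewrite (hopE yw pw) // py.
Qed.

(** Levels agree because edges between sheets are level. Slopes are preserved because
    [cross_transport] yields a neighbor that uniqueness identifies with the hop. *)
Lemma hop_morph x z : e x z -> pi x <> pi z ->
  sheet_morph (pi x) (pi z) (hop (pi z)) (hop (pi x)).
Proof.
move=> xz npi; split=> [y py|y y' py yy'].
  have [yw pw] := hopP xz npi py; split=> //.
    by apply: hopE; rewrite // 1?e_sym ?pw // => /esym.
  by apply/esym/cross_level; rewrite // py pw.
have [yw pw] := hopP xz npi py.
have nwy : pi (hop (pi z) y) <> pi y by rewrite pw py => /esym.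
have [w y'w [pw' sl]] := cross_transport yy' yw nwy.
by rewrite (hopE y'w) // -?(summit_slope yy') ?py // pw' pw.
Qed.

Lemma hop_iso x z : e x z -> pi x <> pi z ->
  sheet_iso (pi x) (pi z) (hop (pi z)) (hop (pi x)).
Proof.
by move=> xz npi; split; apply: hop_morph; rewrite // 1?e_sym // => /esym.
Qed.

Lemma exists_sheet_iso x y : connect e x y ->
  exists th, exists th', sheet_iso (pi x) (pi y) th th'.
Proof.
case/connectP => p; elim: p x => [|z p IHp] x /=.
  by move=> _ ->; exists id, id; exact: sheet_iso_id.
case/andP => xz zp /(IHp _ zp)[th [th' iso]].
have [eq_pi|/eqP npi] := eqVneq (pi x) (pi z); first
  by exists th, th'; rewrite eq_pi.
do 2!eexists; apply: sheet_iso_comp iso; exact: hop_iso.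
Qed.

End SheetIsomorphisms.

(** * Rigidity of sharp eigenfunctions *)

Section Bochner.
Variables (R : realType) (G : sgraph).
Implicit Types (f g h : G -> R) (x y z : G).

Lemma sum_Lap h : \sum_x Lap h x = 0.
Proof.
have flip : \sum_x Lap h x = - \sum_x Lap h x.
  rewrite [LHS](exchange_big_dep xpredT) //= -sumrN; apply: eq_bigr => y _.
  rewrite -sumrN; apply: eq_big => [x|x _]; first by rewrite edge_sym.
  by rewrite opprB.
lra.
Qed.

Lemma LapD f g t :
  Lap (fun y => f y + t * g y) = fun x => Lap f x + t * Lap g x.
Proof.
apply/funext => x; rewrite /Lap mulr_sumr -big_split.
by apply: eq_bigr => y _ /=; ring.
Qed.

Lemma GamC f g : Gam f g = Gam g f.
Proof.
by apply/funext => x; congr (_ * _); apply: eq_bigr => y _; rewrite mulrC.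
Qed.

Lemma GamD f g h t :
  Gam (fun y => f y + t * g y) h = fun x => Gam f h x + t * Gam g h x.
Proof.
apply/funext => x; rewrite /Gam mulrCA -mulrDr; congr (_ * _).
by rewrite mulr_sumr -big_split; apply: eq_bigr => y _ /=; ring.
Qed.

Lemma GamZ f h t : Gam (fun y => t * f y) h = fun x => t * Gam f h x.
Proof.
apply/funext => x; rewrite /Gam mulrCA; congr (_ * _).
by rewrite mulr_sumr; apply: eq_bigr => y _ /=; ring.
Qed.

Lemma Gam2C f g x : Gam2 f g x = Gam2 g f x.
Proof. by rewrite /Gam2 [Gam f g]GamC; ring. Qed.

Lemma Gam2D f g h t x :
  Gam2 (fun y => f y + t * g y) h x = Gam2 f h x + t * Gam2 g h x.
Proof.
by rewrite /Gam2 GamD LapD LapD GamD [Gam h _]GamC GamD ![Gam _ h]GamC; ring.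
Qed.

Lemma Gam_quadratic f g t x :
  Gam (fun y => f y + t * g y) (fun y => f y + t * g y) x =
  Gam f f x + 2 * t * Gam f g x + t ^+ 2 * Gam g g x.
Proof.
set h := fun y => _; rewrite {1}/h GamD (GamC f h) (GamC g h) !GamD (GamC g f).
ring.
Qed.

Lemma Gam2_quadratic f g t x :
  Gam2 (fun y => f y + t * g y) (fun y => f y + t * g y) x =
  Gam2 f f x + 2 * t * Gam2 f g x + t ^+ 2 * Gam2 g g x.
Proof.
set h := fun y => _; rewrite {1}/h Gam2D (Gam2C f h) (Gam2C g h) !Gam2D.
by rewrite (Gam2C g f); ring.
Qed.

Lemma Gam_ge0 f x : 0 <= Gam f f x.
Proof.
apply: mulr_ge0; first by rewrite invr_ge0.
by apply: sumr_ge0 => y _; rewrite -expr2 sqr_ge0.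
Qed.

(** Summation by parts: the Laplacian of the square of [f] is [2 * Gam f f + 2 * f * Lap f] and sums
    to zero. *)
Lemma sum_Gam f : \sum_x Gam f f x = - \sum_x f x * Lap f x.
Proof.
have LapM x : Lap (fun y => f y * f y) x = 2 * Gam f f x + 2 * (f x * Lap f x).
  rewrite /Gam /Lap mulVKf ?pnatr_eq0 // !mulr_sumr.
  by rewrite -big_split; apply: eq_bigr => y _ /=; ring.
have := sum_Lap (fun y => f y * f y).
under eq_bigr do rewrite LapM.
rewrite big_split /= -!mulr_sumr; lra.
Qed.

Lemma quadratic_ge0_linear_eq0 (B C : R) :
  (forall t, 0 <= t * B + t ^+ 2 * C) -> B = 0.
Proof.
move=> ge0; apply/eqP/negPn/negP => B0.
have D0 : 0 < `|C| + 1 by rewrite ltr_pwDr.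
(* At this [t] the form is a nonzero square times [C - (|C| + 1)], hence negative. *)
have := ge0 (- B / (`|C| + 1)).
have -> : - B / (`|C| + 1) * B + (- B / (`|C| + 1)) ^+ 2 * C =
    (B / (`|C| + 1)) ^+ 2 * (C - (`|C| + 1)).
  by field; rewrite gt_eqF.
rewrite pmulr_rge0 ?exprn_even_gt0 ?mulf_neq0 ?invr_eq0 ?(gt_eqF D0) //.
have := ler_norm C; lra.
Qed.

Definition eigenfunction K f := forall x, Lap f x = - K * f x.

Lemma eigen_Lap K f : eigenfunction K f -> Lap f = fun x => - K * f x.
Proof. by move=> fK; apply/funext. Qed.

(** Integrated Bochner formula: pointwise, [Gam2 f f] is half of [Lap (Gam f f)] plus [K * Gam f f],
    and a Laplacian sums to zero. *)
Lemma sum_Gam2_eigen K f : eigenfunction K f ->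
  \sum_x Gam2 f f x = K * \sum_x Gam f f x.
Proof.
move=> fK; have E x : Gam2 f f x = 2^-1 * Lap (Gam f f) x + K * Gam f f x.
  rewrite /Gam2 (eigen_Lap fK) [Gam f (fun y => _ * _)]GamC GamZ; lra.
under eq_bigr do rewrite E.
by rewrite big_split /= -!mulr_sumr sum_Lap mulr0 add0r.
Qed.

(* An eigenfunction for the curvature bound minimizes the nonnegative quadratic
   form [Gam2 - K * Gam] at each vertex, so it lies in the kernel of its polar
   form. *)
Lemma sharp_Gam2 K f : CD G K -> eigenfunction K f ->
  forall g x, Gam2 f g x = K * Gam f g x.
Proof.
move=> cd fK.
have eqf x : Gam2 f f x = K * Gam f f x.
  have nonneg y : 0 <= Gam2 f f y - K * Gam f f y by rewrite subr_ge0; apply: cd.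
  have : \sum_y (Gam2 f f y - K * Gam f f y) == 0.
    by rewrite sumrB -[X in _ - X]mulr_sumr (sum_Gam2_eigen fK) subrr.
  rewrite psumr_eq0 // => /allP/(_ x (mem_index_enum x)) /=.
  by rewrite subr_eq0 => /eqP.
move=> g x; suff : 2 * (Gam2 f g x - K * Gam f g x) = 0 by lra.
apply: (@quadratic_ge0_linear_eq0 _ (Gam2 g g x - K * Gam g g x)) => t.
have := cd (fun y => f y + t * g y) x.
rewrite -subr_ge0 Gam_quadratic Gam2_quadratic eqf.
by congr (_ <= _); ring.
Qed.

Definition degree x : R := \sum_(y | edge x y) 1.

Definition delta z : G -> R := fun y => (y == z)%:R.

Lemma sum_edge_delta x z (F : G -> R) :
  \sum_(w | edge x w) (w == z)%:R * F w = (edge x z)%:R * F z.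
Proof.
rewrite big_mkcond (bigD1 z) //= eqxx big1 => [|w /negbTE ->].
  by rewrite addr0; case: edge; rewrite ?mul1r ?mul0r.
by rewrite mul0r; case: ifP.
Qed.

Lemma sum_edge_common x z (F : G -> R) :
  \sum_(w | edge x w) (edge w z)%:R * F w =
  \sum_(w | edge x w && edge z w) F w.
Proof.
rewrite [RHS]big_mkcondr; apply: eq_bigr => w _.
by rewrite [edge z w]edge_sym; case: edge; rewrite ?mul1r ?mul0r.
Qed.

Lemma Lap_delta z y :
  Lap (delta z) y = (edge y z)%:R - (y == z)%:R * degree z.
Proof.
rewrite /Lap sumrB; congr (_ - _).
  have := sum_edge_delta y z (fun=> 1); rewrite mulr1 => <-.
  by apply: eq_bigr => w _; rewrite mulr1.
rewrite /delta /degree; case: eqP => [->|_]; first by rewrite mul1r.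
by rewrite mul0r big1.
Qed.

Lemma Gam_delta f z y :
  Gam f (delta z) y =
  2^-1 * ((edge y z)%:R * (f z - f y) - (y == z)%:R * Lap f z).
Proof.
rewrite /Gam; congr (_ * _).
under eq_bigr do rewrite mulrBr.
rewrite sumrB -mulr_suml; congr (_ - _).
  rewrite -(sum_edge_delta y z (fun w => f w - f y)).
  by apply: eq_bigr => w _; rewrite mulrC.
by rewrite /delta mulrC; case: eqP => [->|_] //; rewrite !mul0r.
Qed.

Lemma sharp_delta K f : CD G K -> eigenfunction K f -> forall z x,
  Lap (Gam f (delta z)) x - Gam f (Lap (delta z)) x = K * Gam f (delta z) x.
Proof.
move=> cd fK z x; have := sharp_Gam2 cd fK (delta z) x.
rewrite /Gam2 [Gam (delta z) _]GamC (eigen_Lap fK) GamZ; lra.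
Qed.

(** The polar identity for [f] and the indicator of [z], expanded at [x] over common neighbors. The
    case [x = z] fixes [K]; for [x != z] it becomes the balance law when the first term on the right
    vanishes. *)
Lemma sharp_local K f z x : CD G K -> eigenfunction K f ->
  \sum_(w | edge x w && edge z w) (f x + f z - 2 * f w) =
    (edge x z)%:R * (f z - f x) * (degree x - degree z) +
    (x == z)%:R * (K ^+ 2 * f z).
Proof.
move=> cd fK; have := sharp_delta cd fK z x.
pose S1 := \sum_(w | edge x w && edge z w) (f z - f w).
pose S2 := \sum_(w | edge x w && edge z w) (f w - f x).
have -> : Lap (Gam f (delta z)) x =
    2^-1 * (S1 - (edge x z)%:R * Lap f z) - degree x * Gam f (delta z) x.
  rewrite {1}/Lap sumrB mulr_suml; congr (_ - _).
    under eq_bigr do rewrite Gam_delta.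
    rewrite -mulr_sumr sumrB sum_edge_common.
    by rewrite (sum_edge_delta _ _ (fun=> Lap f z)).
  by apply: eq_bigr => w _; rewrite mul1r.
have -> : Gam f (Lap (delta z)) x =
    2^-1 * (S2 - (edge x z)%:R * (f z - f x) * degree z
                - Lap f x * Lap (delta z) x).
  rewrite /Gam; congr (_ * _).
  have -> : Lap f x * Lap (delta z) x =
      \sum_(w | edge x w) (f w - f x) * Lap (delta z) x by rewrite mulr_suml.
  rewrite /S2 -sum_edge_common.
  rewrite -(sum_edge_delta x z (fun w => (f w - f x))) mulr_suml -!sumrB.
  by apply: eq_bigr => w _; rewrite [Lap _ w]Lap_delta; ring.
have -> : \sum_(w | edge x w && edge z w) (f x + f z - 2 * f w) = S1 - S2.
  by rewrite -sumrB; apply: eq_bigr => w _; ring.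
rewrite Gam_delta Lap_delta !fK; case: (eqVneq x z) => [->|_] /=; last lra.
by rewrite edge_irrefl => eq1; lra.
Qed.

(** On the diagonal [sharp_local] reads [2 * K * f z = K ^+ 2 * f z]. *)
Lemma sharp_constant K f z : CD G K -> eigenfunction K f -> 0 < K ->
  f z != 0 -> K = 2.
Proof.
move=> cd fK K0 fz; have := sharp_local z z cd fK.
have -> : \sum_(w | edge z w && edge z w) (f z + f z - 2 * f w) = - 2 * Lap f z.
  by rewrite /Lap mulr_sumr; apply: eq_big => [w|w _]; rewrite ?andbb //; ring.
rewrite fK edge_irrefl eqxx /= => eqK.
apply: (mulIf fz); apply: (mulfI (lt0r_neq0 K0)); lra.
Qed.

Lemma sharp_balanced K f : CD G K -> eigenfunction K f -> balanced (@edge G) f.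
Proof.
move=> cd fK x z xz flat; rewrite (sharp_local z x cd fK) (negbTE xz) mul0r addr0.
by case/orP: flat => [/negbTE->|/eqP->]; rewrite ?subrr ?mulr0 ?mul0r.
Qed.

(** Summing the curvature bound compares [K] and [mu] times the same energy, which is positive since
    it equals [mu] times the sum of squares of [f]. *)
Lemma lichnerowicz_estimate K mu f : CD G K -> eigenfunction mu f ->
  0 < mu -> (exists x, f x != 0) -> K <= mu.
Proof.
move=> cd fmu mu0 [x fx].
have Gpos : 0 < \sum_y Gam f f y.
  rewrite sum_Gam -sumrN.
  under eq_bigr do rewrite fmu mulNr mulrN opprK mulrCA.
  rewrite -mulr_sumr pmulr_rgt0 // (bigD1 x) //= ltr_pwDl //.
    by rewrite -expr2 exprn_even_gt0.
  by apply: sumr_ge0 => y _; rewrite -expr2 sqr_ge0.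
rewrite -(ler_pM2r Gpos) -(sum_Gam2_eigen fmu) mulr_sumr.
by apply: ler_sum => y _; apply: cd.
Qed.

Lemma eigen_ge0 mu f : eigenfunction mu f -> (exists x, f x != 0) -> 0 <= mu.
Proof.
move=> fmu [x fx]; rewrite leNgt; apply/negP => mu0.
have : 0 <= \sum_y Gam f f y by apply: sumr_ge0 => y _; exact: Gam_ge0.
rewrite sum_Gam -sumrN leNgt => /negP; apply.
under eq_bigr do rewrite fmu mulNr mulrN opprK mulrCA.
rewrite -mulr_sumr nmulr_rlt0 // (bigD1 x) //= ltr_pwDl //.
  by rewrite -expr2 exprn_even_gt0.
by apply: sumr_ge0 => y _; rewrite -expr2 sqr_ge0.
Qed.

End Bochner.

(** * The spectrum of the Laplacian *)

Section Spectrum.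
Variables (R : realType) (G : sgraph).
Implicit Types (f h : G -> R) (v : 'rV[R]_#|G|) (mu : R).

Definition row_fun v : G -> R := fun x => v 0 (enum_rank x).

Lemma Lap_sum_delta h y : Lap h y = \sum_z h z * Lap (delta R z) y.
Proof.
under eq_bigr do rewrite Lap_delta mulrBr.
rewrite sumrB /Lap sumrB; congr (_ - _).
  rewrite big_mkcond; apply: eq_bigr => z _.
  by case: edge; rewrite ?mulr1 ?mulr0.
rewrite [RHS](bigD1 y) //= eqxx mul1r [X in _ + X]big1 ?addr0 => [|z neq].
  by rewrite /degree mulr_sumr; apply: eq_bigr => z _; rewrite mulr1.
by rewrite eq_sym (negbTE neq) mul0r mulr0.
Qed.

Lemma mul_neg_Lap v j :
  (v *m neg_Lap_mx R G) 0 j = - Lap (row_fun v) (enum_val j).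
Proof.
rewrite mxE Lap_sum_delta (reindex (@enum_val G (mem G))) /=; last first.
  exact/onW_bij/enum_val_bij.
rewrite -sumrN; apply: eq_bigr => i _.
by rewrite mxE mulrN /row_fun enum_valK.
Qed.

Lemma eigen_row v mu :
  v *m neg_Lap_mx R G = mu *: v <-> eigenfunction mu (row_fun v).
Proof.
split=> [vA x|ef].
  apply: oppr_inj; rewrite -[x in LHS]enum_rankK -mul_neg_Lap vA mxE.
  by rewrite mulNr opprK.
apply/rowP => j; rewrite mul_neg_Lap ef mxE mulNr opprK.
by rewrite /row_fun enum_valK.
Qed.

Definition fun_row f : 'rV[R]_#|G| := \row_i f (enum_val i).

Lemma fun_rowK f : row_fun (fun_row f) = f.
Proof. by apply/funext => x; rewrite /row_fun mxE enum_rankK. Qed.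

Lemma row_fun_neq0 v : v != 0 <-> exists x, row_fun v x != 0.
Proof.
split=> [|[x]]; last by apply: contraNneq => ->; rewrite /row_fun mxE.
case/rV0Pn => i vi; exists (enum_val i); by rewrite /row_fun enum_valK.
Qed.

Lemma eigenvalue_eigenfunction mu : eigenvalue (neg_Lap_mx R G) mu <->
  exists2 f : G -> R, eigenfunction mu f & exists x, f x != 0.
Proof.
split=> [/eigenvalueP[v /eigen_row ef /row_fun_neq0 v0]|[f ef f0]].
  by exists (row_fun v).
apply/eigenvalueP; exists (fun_row f); first by apply/eigen_row; rewrite fun_rowK.
by apply/row_fun_neq0; rewrite fun_rowK.
Qed.

Lemma rootsR_char_poly n (A : 'M[R]_n) mu :
  (mu \in rootsR (char_poly A)) = eigenvalue A mu.
Proof.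
rewrite eigenvalue_root_char -(roots_on_rootsR (monic_neq0 (char_poly_monic A))).
by rewrite in_itv.
Qed.

Lemma mem_eigenvalues mu :
  (mu \in eigenvalues R G) = eigenvalue (neg_Lap_mx R G) mu.
Proof.
apply/flatten_mapP/idP => [[l]|ev].
  by rewrite rootsR_char_poly mem_nseq => ev /andP[_ /eqP->].
exists mu; first by rewrite rootsR_char_poly.
by rewrite mem_nseq eqxx lt0n mxrank_eq0 andbT.
Qed.

Lemma sharp_eigenfunction : lichnerowicz_sharp R G ->
  exists f : G -> R,
    [/\ CD G (2 : R), eigenfunction (2 : R) f & exists x, f x != 0].
Proof.
case=> K [K0 cd lamK].
have /eigenvalue_eigenfunction[f ef [x fx]] :
    eigenvalue (neg_Lap_mx R G) K.
  (* A positive [lambda 1] is not the default [0] of [nth], so the index is in range. *)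
  rewrite -mem_eigenvalues -lamK; apply: mem_nth; rewrite ltnNge.
  by apply: contraTN K0 => le1; rewrite -lamK /lambda nth_default // ltxx.
have K2 := sharp_constant cd ef K0 fx.
by exists f; rewrite -K2; split=> //; exists x.
Qed.

End Spectrum.

(** * Real eigenvalues of real symmetric matrices *)

Section SymmetricMatrix.
Variables (R : rcfType) (n : nat) (A : 'M[R]_n).
Hypothesis symA : A^T = A.

Local Notation ReC := (@complex.Re R).
Local Notation ImC := (@complex.Im R).
Local Notation AC := (map_mx (real_complex R) A).

Lemma Re_mul_real (v : 'rV[R[i]]_n) :
  map_mx ReC (v *m AC) = map_mx ReC v *m A.
Proof.
apply/rowP => j; rewrite !mxE (big_morph ReC (id1 := 0) (op1 := +%R)) //.
  apply: eq_bigr => i _; rewrite !mxE.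
  by case: (v 0 i) => x y /=; rewrite mulr0 subr0.
by case=> x y [x' y'].
Qed.

Lemma Im_mul_real (v : 'rV[R[i]]_n) :
  map_mx ImC (v *m AC) = map_mx ImC v *m A.
Proof.
apply/rowP => j; rewrite !mxE (big_morph ImC (id1 := 0) (op1 := +%R)) //.
  apply: eq_bigr => i _; rewrite !mxE.
  by case: (v 0 i) => x y /=; rewrite mulr0 add0r.
by case=> x y [x' y'].
Qed.

Lemma row_sqr_sum m (v : 'rV[R]_m) : (v *m v^T) 0 0 = \sum_i v 0 i ^+ 2.
Proof. by rewrite mxE; apply: eq_bigr => i _; rewrite mxE expr2. Qed.

Lemma row_sqr_ge0 m (v : 'rV[R]_m) : 0 <= (v *m v^T) 0 0.
Proof. by rewrite row_sqr_sum; apply: sumr_ge0 => i _; rewrite sqr_ge0. Qed.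

Lemma row_sqr_eq0 m (v : 'rV[R]_m) : (v *m v^T) 0 0 = 0 -> v = 0.
Proof.
rewrite row_sqr_sum => /eqP; rewrite psumr_eq0 => [/allP all0|i _].
  apply/rowP => i; have := all0 i (mem_index_enum i).
  by rewrite mxE /= sqrf_eq0 => /eqP.
exact: sqr_ge0.
Qed.

(* Splitting [v A = z v] into real and imaginary parts [a] and [b], symmetry of
   [A] equates [a A b^T] with [b A a^T], whence [Im z * (|a|^2 + |b|^2) = 0]. *)
Lemma symmetric_real_eigenvalue (z : R[i]) :
  eigenvalue AC z -> ImC z = 0 /\ eigenvalue A (ReC z).
Proof.
move=> /eigenvalueP[v vA v0].
pose a := map_mx ReC v; pose b := map_mx ImC v.
have aA : a *m A = ReC z *: a - ImC z *: b.
  rewrite -Re_mul_real vA; apply/rowP => j; rewrite !mxE.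
  by case: (v 0 j) => x y; case: (z).
have bA : b *m A = ReC z *: b + ImC z *: a.
  rewrite -Im_mul_real vA; apply/rowP => j; rewrite !mxE.
  by case: (v 0 j) => x y; case: (z).
have ab0 : ImC z * ((a *m a^T) 0 0 + (b *m b^T) 0 0) = 0.
  have tr11 (M : 'M[R]_1) : M 0 0 = M^T 0 0 by rewrite mxE.
  have : (a *m A *m b^T) 0 0 = (b *m A *m a^T) 0 0.
    by rewrite [RHS]tr11 !trmx_mul trmxK symA mulmxA.
  have ba : (b *m a^T) 0 0 = (a *m b^T) 0 0 by rewrite tr11 trmx_mul trmxK.
  rewrite aA bA mulmxBl mulmxDl -!scalemxAl.
  move: ba; move: (a *m a^T) (b *m b^T) (a *m b^T) (b *m a^T) => p q r s sr.
  rewrite !mxE sr; lra.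
have [a0|nz] := eqVneq (ImC z) 0; last first.
  move/eqP: ab0; rewrite mulf_eq0 (negbTE nz) /= paddr_eq0 ?row_sqr_ge0 //.
  case/andP => /eqP/row_sqr_eq0 a0 /eqP/row_sqr_eq0 b0; case/negP: v0.
  apply/eqP/rowP => i; have /rowP/(_ i) := a0; have /rowP/(_ i) := b0.
  by rewrite !mxE; case: (v 0 i) => x y /= -> ->.
split=> //; move: aA bA; rewrite a0 !scale0r subr0 addr0 => aA bA.
apply/eigenvalueP; have [za|] := eqVneq a 0; last by exists a.
exists b => //; apply: contra_neq v0 => zb.
apply/rowP => i; have /rowP/(_ i) := za; have /rowP/(_ i) := zb.
by rewrite !mxE; case: (v 0 i) => x y /= -> ->.
Qed.

(* If all complex eigenvalues vanished, the characteristic polynomial would be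
   ['X^n], which has no trace term. *)
Lemma symmetric_nonzero_eigenvalue : \tr A != 0 ->
  exists2 mu, mu != 0 & eigenvalue A mu.
Proof.
move=> trA; have n0 : (0 < n)%N.
  rewrite lt0n; apply: contra_neq trA => n0.
  by rewrite /mxtrace big1 // => i _; have := ltn_ord i; rewrite {2}n0.
have [r] := closed_field_poly_normal (char_poly AC).
rewrite (monicP (char_poly_monic AC)) scale1r => chi.
have [/hasP[z zr z0]|/hasPn all0] := boolP (has (fun z => z != 0) r).
  have : eigenvalue AC z by rewrite eigenvalue_root_char chi root_prod_XsubC.
  case/symmetric_real_eigenvalue => Imz ev; exists (ReC z) => //.
  by apply: contra_neq z0 => Rez; move: Imz Rez; case: (z) => x y /= -> ->.
have := char_poly_trace AC n0.
have -> : char_poly AC = 'X^n.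
  have sz : size r = n.
    by have := size_char_poly AC; rewrite chi size_prod_XsubC => -[].
  rewrite chi -[in RHS]sz big_seq -[RHS]mulr1.
  rewrite (eq_bigr (fun=> 'X)) => [|z /all0]; last first.
    by rewrite negbK => /eqP->; rewrite subr0.
  by rewrite -big_seq big_const_seq count_predT iter_mulr mulr1.
rewrite coefXn -{2}(prednK n0) ltn_eqF // trace_map_mx => /esym/eqP.
by rewrite oppr_eq0 fmorph_eq0 (negbTE trA).
Qed.

End SymmetricMatrix.

(** * Positivity of [lambda 1] on a connected graph *)

Section LambdaOne.
Variables (R : realType) (G : sgraph).
Hypothesis conn : graph_connected G.
Hypothesis nontriv : (1 < #|G|)%N.

Local Notation A := (neg_Lap_mx R G).

Lemma neg_Lap_sym : A^T = A.
Proof.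
apply/matrixP => i j; rewrite !mxE !Lap_delta edge_sym.
rewrite !(inj_eq enum_val_inj) [j == i]eq_sym.
by case: eqVneq => [->//|_]; rewrite !mul0r.
Qed.

Lemma degree_ge0 (x : G) : 0 <= degree R x.
Proof. by apply: sumr_ge0. Qed.

Lemma neg_Lap_trace : \tr A != 0.
Proof.
have trE : \tr A = \sum_(x : G) degree R x.
  rewrite [in RHS](reindex (@enum_val G (mem G))) /=; last first.
    exact/onW_bij/enum_val_bij.
  apply: eq_bigr => i _; rewrite mxE Lap_delta edge_irrefl eqxx.
  by rewrite mul1r sub0r opprK.
rewrite trE; have [G0 connG] := conn.
have /card_gt1P[x [y [_ _ neq]]] := nontriv.
have /connectP[[|z p] /=] := connG x y.
  by move=> _ eqxy; rewrite eqxy eqxx in neq.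
case/andP => xz _ _; rewrite gt_eqF // (bigD1 x) //= ltr_pwDl //.
  rewrite /degree (bigD1 z) //= ltr_pwDl //; exact: sumr_ge0.
by apply: sumr_ge0 => w _; exact: degree_ge0.
Qed.

Lemma eigen0_constant (f : G -> R) : eigenfunction 0 f -> forall x y, f x = f y.
Proof.
move=> ef; have flat x y : edge x y -> f x = f y.
  move=> xy; have /eqP := sum_Gam f.
  rewrite [X in _ == - X]big1 => [|z _]; last by rewrite ef oppr0 mul0r mulr0.
  rewrite oppr0 psumr_eq0 => [/allP/(_ x (mem_index_enum x))|z _]; last first.
    exact: Gam_ge0.
  rewrite /= /Gam mulf_eq0 invr_eq0 pnatr_eq0 /= psumr_eq0 => [|z _]; last first.
    by rewrite -expr2 sqr_ge0.
  move/allP/(_ y (mem_index_enum y)); rewrite xy /= -expr2 sqrf_eq0 subr_eq0.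
  by move/eqP.
move=> x y; have /connectP[p] := conn.2 x y.
elim: p x => [|z p IHp] x /=; first by move=> _ ->.
by case/andP => /flat-> /IHp h /h.
Qed.

Lemma rank_eigenspace0 : (\rank (eigenspace A 0) <= 1)%N.
Proof.
suff sub : (eigenspace A 0 <= (const_mx 1 : 'rV[R]_#|G|))%MS.
  exact: leq_trans (mxrankS sub) (rank_leq_row _).
apply/row_subP => i; set v := row i _.
have /eigenspaceP/eigen_row/eigen0_constant cst : (v <= eigenspace A 0)%MS.
  exact: row_sub.
have [x _] : exists x : G, true by have /card_gt0P[x] := conn.1; exists x.
apply/sub_rVP; exists (row_fun v x); apply/rowP => j.
rewrite [RHS]mxE [const_mx _ _ _]mxE mulr1 (cst x (enum_val j)).
by rewrite /row_fun enum_valK.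
Qed.

Lemma count_flatten_nseq (r : R -> nat) (s : seq R) (l : R) : uniq s ->
  (count_mem l (flatten [seq nseq (r k) k | k <- s]) <= r l)%N.
Proof.
elim: s => //= k s IHs /andP[ks us]; rewrite count_cat count_nseq /=.
have [kl|_] := eqVneq k l; last by rewrite mul0n IHs.
rewrite mul1n kl (count_memPn _) ?addn0 //; apply/flatten_mapP => -[m ms].
by rewrite mem_nseq => /andP[_ /eqP lm]; rewrite kl lm ms in ks.
Qed.

Lemma sorted_flatten_nseq (r : R -> nat) (s : seq R) : sorted <%R s ->
  sorted <=%R (flatten [seq nseq (r k) k | k <- s]).
Proof.
rewrite (sorted_pairwise lt_trans) (sorted_pairwise le_trans).
elim: s => //= k s IHs /andP[ks us]; rewrite pairwise_cat IHs // andbT.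
apply/andP; split; last by elim: (r k) => //= m ->; rewrite all_nseq lexx orbT.
apply/allrelP => x y; rewrite mem_nseq => /andP[_ /eqP->] /flatten_mapP[l ls].
by rewrite mem_nseq => /andP[_ /eqP->]; apply/ltW/(allP ks).
Qed.

(** The eigenvalue list is sorted and nonnegative, contains [0] exactly once because the kernel
    consists of constants, and contains a nonzero value because the trace is nonzero. So index 1 is
    in range and its entry is positive. *)
Lemma lambda1_eigen : 0 < lambda R G 1 /\
  exists2 f : G -> R, eigenfunction (lambda R G 1) f & exists x, f x != 0.
Proof.
have sorted_roots : sorted <%R (rootsR (char_poly A)) by exact: sorted_roots.
have nonneg mu : mu \in eigenvalues R G -> 0 <= mu.
  by rewrite mem_eigenvalues => /eigenvalue_eigenfunction[f /eigen_ge0]; apply.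
have [mu mu0] := symmetric_nonzero_eigenvalue neg_Lap_sym neg_Lap_trace.
rewrite -mem_eigenvalues => mu_in.
have zero_in : 0 \in eigenvalues R G.
  rewrite mem_eigenvalues; apply/eigenvalue_eigenfunction; exists (fun=> 1).
    by move=> x; rewrite /Lap oppr0 mul0r big1 // => y _; rewrite subrr.
  by have /card_gt0P[x _] := conn.1; exists x; rewrite oner_eq0.
have count0 : (count_mem (0%R : R) (eigenvalues R G) <= 1)%N.
  apply: leq_trans rank_eigenspace0.
  apply: (count_flatten_nseq (fun l => \rank (eigenspace A l))).
  exact: lt_sorted_uniq.
have sorted_e : sorted <=%R (eigenvalues R G) by exact: sorted_flatten_nseq.
have [size_e lam0] : (1 < size (eigenvalues R G))%N /\ 0 < lambda R G 1.
  rewrite /lambda; case: (eigenvalues R G) sorted_e nonneg count0 mu_in zero_in.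
    by [].
  move=> l0 [|l1 s] /=.
    move=> _ _ _; rewrite !inE => /eqP mul /eqP l00.
    by rewrite mul -l00 eqxx in mu0.
  case/andP => le01 _ nonneg cnt _ _; split=> //.
  rewrite lt_neqAle nonneg ?inE ?eqxx ?orbT // andbT eq_sym.
  apply/eqP => l10; move: cnt; rewrite l10 eqxx.
  have -> : l0 = 0; last by rewrite eqxx.
  by apply/eqP; rewrite eq_le nonneg ?inE ?eqxx // -l10 le01.
split=> //; apply/eigenvalue_eigenfunction; rewrite -mem_eigenvalues.
exact: mem_nth.
Qed.

End LambdaOne.

(** * A single eigenfunction that detects every visible edge *)

Section GenericEigenfunction.
Variables (R : realType) (G : sgraph).

Lemma E2_eigenfunction (a : G -> R) : E2 a <-> eigenfunction (2 : R) a.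
Proof. by split=> E x; have := E x; lra. Qed.

Lemma E2D (a b : G -> R) t : E2 a -> E2 b -> E2 (fun x => a x + t * b x).
Proof. by move=> Ea Eb x; rewrite LapD; have := Ea x; have := Eb x; nra. Qed.

Lemma exists_notin (s : seq R) : exists t, t \notin s.
Proof.
have [M ltM] : exists M, all (fun y => y < M) s.
  elim: s => [|x s [M ltM]]; first by exists 0.
  exists (Num.max M (x + 1)) => /=; rewrite lt_max ltrDl ltr01 orbT /=.
  by apply: sub_all ltM => y yM; rewrite lt_max yM.
by exists M; apply/negP => /(allP ltM); rewrite ltxx.
Qed.

Lemma exists_generic_seq (s : seq (G * G)) :
  (forall p, p \in s -> exists a : G -> R, E2 a /\ a p.1 <> a p.2) ->
  exists2 f : G -> R, E2 f & forall p, p \in s -> f p.1 <> f p.2.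
Proof.
elim: s => [|p s IHs] sep.
  exists (fun=> 0) => // x; rewrite /Lap mulr0 addr0 big1 // => y _.
  by rewrite subrr.
have [|f Ef fs] := IHs; first by move=> q qs; apply: sep; rewrite inE qs orbT.
have [a [Ea ap]] := sep p (mem_head p s).
(* Where [a] separates a pair, exactly one [t] makes the new function agree on it, and the list
   collects these values. Where [a] does not, the entry is a junk [0] and [f] already separates the
   pair. *)
have [t t_good] := exists_notin
  [seq (f q.1 - f q.2) / (a q.2 - a q.1) | q <- p :: s].
exists (fun x => f x + t * a x); first exact: E2D.
move=> q qs eq_q; have [aq|aq] := eqVneq (a q.2 - a q.1) 0.
  have aq12 : a q.1 = a q.2 by lra.
  move: qs; rewrite inE => /predU1P[qp|/fs]; first by apply: ap; rewrite -qp.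
  by apply; move: eq_q; rewrite aq12 => /addIr.
case/negP: t_good; apply/mapP; exists q => //.
by apply: (mulIf aq); rewrite divfK //; lra.
Qed.

Lemma exists_generic : exists2 f : G -> R, E2 f &
  forall x y, visible R x y = slope (@edge G) f x y.
Proof.
have [|f Ef fs] := @exists_generic_seq
  [seq p <- enum {: G * G} | visible R p.1 p.2].
  by move=> p; rewrite mem_filter => /andP[/andP[_ /asboolP]].
exists f => // x y; apply/idP/idP => [vis|/andP[xy fxy]].
  rewrite /slope; have /andP[-> _] := vis; apply/eqP.
  by apply: (fs (x, y)); rewrite mem_filter vis mem_enum.
by rewrite /visible xy; apply/asboolP; exists f; split=> //; apply/eqP.
Qed.

End GenericEigenfunction.

(** * The quotient graph and the bundle *)

Section Quotient.
Variables (R : realType) (G : sgraph).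
Hypothesis conn : graph_connected G.
Variables (f : G -> R) (pi : G -> G).
Hypothesis bal : balanced (@edge G) f.
Hypothesis piP : summit_map (@edge G) f pi.
Hypothesis visE : forall x y, visible R x y = slope (@edge G) f x y.

Let e_sym := @edge_sym G.

Definition fiber (c : G) : {set G} := [set y | pi y == c].

Lemma connect_Gvis x y : connect (@edge (Gvis R G)) x y = (pi x == pi y).
Proof. by rewrite -(connect_slopeE e_sym bal piP); exact: eq_connect. Qed.

Lemma componentsP (C : {set G}) :
  reflect (exists x, C = fiber (pi x)) (C \in components (Gvis R G)).
Proof.
have E (x : G) : [set y in [set: Gvis R G] | connect (@edge (Gvis R G)) x y]
    = fiber (pi x) by apply/setP => y; rewrite !inE connect_Gvis eq_sym.
apply: (iffP imsetP) => [[x _ ->]|[x ->]]; first by exists x; rewrite E.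
by exists x; rewrite ?inE // E.
Qed.

Lemma fiber_component x : fiber (pi x) \in components (Gvis R G).
Proof. by apply/componentsP; exists x. Qed.

Definition proj x : Gquot R G :=
  exist (fun C : {set G} => C \in components (Gvis R G)) _ (fiber_component x).

Lemma Gquot_fiber (C : Gquot R G) : exists c, pi c = c /\ val C = fiber c.
Proof.
have [x ->] := componentsP _ (valP C).
by exists (pi x); rewrite (summitK piP).
Qed.

(* The peak of a component; it determines the component. *)
Definition label (C : Gquot R G) : G := projT1 (cid (Gquot_fiber C)).

Lemma labelK C : pi (label C) = label C.
Proof. by rewrite /label; case: cid => c []. Qed.

Lemma val_label C : val C = fiber (label C).
Proof. by rewrite /label; case: cid => c []. Qed.

Implicit Types C D : Gquot R G.

Lemma label_inj : injective label.
Proof. by move=> C D eqCD; apply: val_inj; rewrite !val_label eqCD. Qed.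

Lemma label_proj x : label (proj x) = pi x.
Proof.
have : x \in val (proj x) by rewrite inE.
by rewrite val_label inE => /eqP.
Qed.

Lemma proj_label C : proj (label C) = C.
Proof. by apply: label_inj; rewrite label_proj labelK. Qed.

Lemma proj_eq x y : (proj x == proj y) = (pi x == pi y).
Proof. by rewrite -(inj_eq label_inj) !label_proj. Qed.

Lemma mem_label x C : (x \in val C) = (pi x == label C).
Proof. by rewrite val_label inE. Qed.

Lemma quot_edgeP C D : reflect
  (exists x y, [/\ edge x y, pi x = label C, pi y = label D &
                   label C <> label D])
  (edge C D).
Proof.
rewrite {2}/edge /= /quot_edge -(inj_eq label_inj).
apply: (iffP andP) => [[/eqP neq /existsP[x /existsP[y /and3P[]]]]|].
  by rewrite !mem_label => /eqP px /eqP py xy; exists x, y.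
case=> x [y [xy px py /eqP neq]]; split=> //.
by apply/existsP; exists x; apply/existsP; exists y; rewrite !mem_label px py !eqxx.
Qed.

Lemma edge_proj x y : edge x y -> pi x <> pi y -> edge (proj x) (proj y).
Proof. by move=> xy neq; apply/quot_edgeP; exists x, y; rewrite !label_proj. Qed.

Lemma quot_hop C D y : edge C D -> pi y = label C ->
  edge y (hop (@edge G) pi (label D) y) /\
  pi (hop (@edge G) pi (label D) y) = label D.
Proof.
case/quot_edgeP => x [z [xz <- <- neq]] py.
exact: (hopP e_sym bal piP xz neq py).
Qed.

Lemma quot_hop_iso C D : edge C D ->
  sheet_iso (@edge G) f pi (label C) (label D)
    (hop (@edge G) pi (label D)) (hop (@edge G) pi (label C)).
Proof.
case/quot_edgeP => x [z [xz <- <- neq]].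
exact: (hop_iso e_sym bal piP xz neq).
Qed.

Lemma hop_edge x y : edge x y -> pi x <> pi y ->
  hop (@edge G) pi (pi y) x = y.
Proof. by move=> xy neq; apply: (hopE e_sym bal piP xy). Qed.

(** On the neighbors of [x] outside its sheet, [proj] is inverted by [hop], so they correspond one
    to one to the neighbors of [proj x]. *)
Lemma sum_proj x (F : Gquot R G -> R) :
  \sum_(D | edge (proj x) D) F D =
  \sum_(y | edge x y && (pi x != pi y)) F (proj y).
Proof.
rewrite [RHS](reindex_onto (fun D => hop (@edge G) pi (label D) x) proj) /=.
  apply/esym/eq_big => [D|D /andP[_ /eqP->] //].
  apply/andP/idP => [[/andP[xh /eqP neq] /eqP hD]|xD].
    by rewrite -hD; apply: edge_proj.
  have [xh ph] := quot_hop xD (esym (label_proj x)).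
  rewrite xh -(inj_eq label_inj) label_proj ph eqxx; split=> //.
  by case/quot_edgeP: xD => _ [_ [_ _ _]]; rewrite label_proj => /eqP.
by move=> y /andP[xy /eqP neq]; rewrite label_proj hop_edge.
Qed.

Lemma sum_proj0 x (F : Gquot R G -> R) : F (proj x) = 0 ->
  \sum_(D | edge (proj x) D) F D = \sum_(y | edge x y) F (proj y).
Proof.
move=> F0; rewrite sum_proj [RHS](bigID (fun y => pi x != pi y)) /=.
rewrite [X in _ = _ + X]big1 ?addr0 // => y /andP[_].
by rewrite negbK -proj_eq => /eqP <-.
Qed.

Implicit Types h k : Gquot R G -> R.

Lemma Lap_proj h x : Lap (h \o proj) x = Lap h (proj x).
Proof.
by rewrite /Lap (sum_proj0 (F := fun D => h D - h (proj x))) // subrr.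
Qed.

Lemma Gam_proj h k x : Gam (h \o proj) (k \o proj) x = Gam h k (proj x).
Proof.
rewrite /Gam (sum_proj0 (F := fun D => (h D - h (proj x)) * (k D - k (proj x)))) //.
by rewrite subrr mul0r.
Qed.

Lemma Gam2_proj h k x : Gam2 (h \o proj) (k \o proj) x = Gam2 h k (proj x).
Proof.
have LapE h' : Lap (h' \o proj) = Lap h' \o proj.
  by apply/funext => y; exact: Lap_proj.
have GamE h' k' : Gam (h' \o proj) (k' \o proj) = Gam h' k' \o proj.
  by apply/funext => y; exact: Gam_proj.
by rewrite /Gam2 !LapE GamE Lap_proj !GamE.
Qed.

(** Lifting along [proj] commutes with [Gam] and [Gam2], and each component is the image of its
    peak. *)
Lemma CD_Gquot (K : R) : CD G K -> CD (Gquot R G) K.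
Proof.
move=> cd h C; rewrite -(proj_label C) -Gam_proj -Gam2_proj; exact: cd.
Qed.

Lemma connect_proj x y : connect (@edge G) x y ->
  connect (@edge (Gquot R G)) (proj x) (proj y).
Proof.
case/connectP => p; elim: p x => [|z p IHp] x /=; first by move=> _ ->.
case/andP => xz /IHp h /h; apply: connect_trans.
have [eq_pi|/eqP neq] := eqVneq (pi x) (pi z).
  by have /eqP-> : proj x == proj z by rewrite proj_eq eq_pi.
exact/connect1/edge_proj.
Qed.

Lemma Gquot_connected : graph_connected (Gquot R G).
Proof.
split; first by have /card_gt0P[x _] := conn.1; apply/card_gt0P; exists (proj x).
by move=> C D; rewrite -(proj_label C) -(proj_label D); apply/connect_proj/conn.2.
Qed.

Lemma lambda1_Gquot : CD G (2 : R) -> #|Gquot R G| <> 1%N ->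
  2 < lambda R (Gquot R G) 1.
Proof.
move=> cd n1; have nontriv : (1 < #|Gquot R G|)%N.
  by have := Gquot_connected.1; case: #|_| n1 => [|[|n]].
have [lam0 [g eg g0]] := lambda1_eigen R Gquot_connected nontriv.
have := lichnerowicz_estimate (CD_Gquot cd) eg lam0 g0.
rewrite le_eqVlt => /predU1P[lam2|//]; rewrite -lam2 in eg.
have Eg : E2 (g \o proj).
  by apply/E2_eigenfunction => x; rewrite Lap_proj eg.
(* If [g] differed across an edge of the quotient, its lift in [E2] would make an edge of [G]
   between the two components visible. So [g] is flat, against the nonzero eigenvalue. *)
have flat C D : edge C D -> g C = g D.
  case/quot_edgeP => x [y [xy px py neq]].
  have Cx : proj x = C by apply: label_inj; rewrite label_proj.
  have Dy : proj y = D by apply: label_inj; rewrite label_proj.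
  apply/eqP/negPn/negP => /eqP gneq; apply: neq.
  rewrite -px -py; apply/eqP; rewrite -connect_Gvis; apply: connect1.
  rewrite /edge /= /visible xy; apply/asboolP; exists (g \o proj).
  by rewrite /= Cx Dy.
case: g0 => C; case/negP; have := eg C.
rewrite /Lap big1 => [|D CD]; last by rewrite (flat _ _ CD) subrr.
by move/eqP; rewrite eq_sym mulf_eq0 oppr_eq0 pnatr_eq0.
Qed.

(** * Charts, transition maps, and the bundle with its section *)

Section Trivialization.
Variable C0 : Gquot R G.

Lemma exists_chart C : exists th : (G -> G) * (G -> G),
  sheet_iso (@edge G) f pi (label C0) (label C) th.1 th.2.
Proof.
have [th [th' iso]] :=
  exists_sheet_iso e_sym bal piP (conn.2 (label C0) (label C)).
by exists (th, th'); rewrite -(labelK C0) -(labelK C).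
Qed.

Definition chart C := projT1 (cid (exists_chart C)).

Lemma chartP C : sheet_iso (@edge G) f pi (label C0) (label C)
  (chart C).1 (chart C).2.
Proof. by rewrite /chart; case: cid. Qed.

Lemma chart1P C u : pi u = label C0 ->
  pi ((chart C).1 u) = label C /\ (chart C).2 ((chart C).1 u) = u.
Proof. by move=> pu; have [[/(_ _ pu)[]]] := chartP C. Qed.

Lemma chart2P C x : pi x = label C ->
  pi ((chart C).2 x) = label C0 /\ (chart C).1 ((chart C).2 x) = x.
Proof. by move=> px; have [_ [/(_ _ px)[]]] := chartP C. Qed.

Lemma chart1_peak C : (chart C).1 (label C0) = label C.
Proof. exact: (sheet_iso_peak e_sym bal piP (chartP C) (labelK C0)). Qed.

Lemma chart2_peak C : (chart C).2 (label C) = label C0.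
Proof.
exact: (sheet_iso_peak e_sym bal piP (sheet_iso_sym (chartP C)) (labelK C)).
Qed.

(** The crossing from [C] to [D], read in the charts over the base component [C0]. *)
Definition transition C D u :=
  (chart D).2 (hop (@edge G) pi (label D) ((chart C).1 u)).

Lemma transitionP C D u : edge C D -> pi u = label C0 ->
  pi (transition C D u) = label C0 /\ transition D C (transition C D u) = u.
Proof.
move=> CD pu; have [pt tK] := chart1P C pu.
have [hP _] := quot_hop_iso CD; have [ph hK _] := hP.1 _ pt.
have [pv vK] := chart2P ph.
by rewrite /transition vK hK tK.
Qed.

Lemma transition_slope C D u v : edge C D ->
  pi u = label C0 -> pi v = label C0 ->
  slope (@edge G) f (transition C D u) (transition C D v) =
  slope (@edge G) f u v.
Proof.
move=> CD pu pv; have iso := sheet_iso_comp (chartP C) (quot_hop_iso CD).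
have := sheet_iso_comp iso (sheet_iso_sym (chartP D)) => /sheet_iso_slope.
exact.
Qed.

Lemma transition_peak C D : edge C D -> transition C D (label C0) = label C0.
Proof.
move=> CD; rewrite /transition chart1_peak.
by rewrite (sheet_iso_peak e_sym bal piP (quot_hop_iso CD) (labelK C)) chart2_peak.
Qed.

Variable H : {set Gvis R G}.
Hypothesis HE : H = fiber (label C0).

Local Notation F := (induced H).

Lemma fiberE x : (x \in H) = (pi x == label C0).
Proof. by rewrite HE inE. Qed.

Lemma pi_val (u : F) : pi (val u) = label C0.
Proof. by apply/eqP; rewrite -fiberE; exact: valP u. Qed.

Lemma label_in_fiber : label C0 \in H.
Proof. by rewrite fiberE labelK. Qed.

Definition fiber_peak : F :=
  exist (fun x : Gvis R G => x \in H) _ label_in_fiber.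

Definition to_fiber x : F := insubd fiber_peak x.

Lemma val_to_fiber x : pi x = label C0 -> val (to_fiber x) = x.
Proof. by move=> px; rewrite val_insubd fiberE px eqxx. Qed.

(** [bundle_data] asks for a permutation at every pair, whereas [transition] is shown to permute the
    fiber for adjacent components; the identity is the default. *)
Definition transition_perm C D : {perm F} :=
  odflt 1%g [pick s : {perm F} |
    [forall u, val (s u) == transition C D (val u)]].

Lemma val_transition_perm C D (u : F) : edge C D ->
  val (transition_perm C D u) = transition C D (val u).
Proof.
move=> CD; rewrite /transition_perm; case: pickP => [s /forallP/(_ u)/eqP //|].
have DC : edge D C by rewrite edge_sym.
pose g C' D' (v : F) := to_fiber (transition C' D' (val v)).
have gK : cancel (g C D) (g D C).
  move=> v; apply: val_inj; have [pv vK] := transitionP CD (pi_val v).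
  have [pw _] := transitionP DC pv.
  by rewrite /g !val_to_fiber.
move/(_ (perm (can_inj gK)))/forallP; case => v.
rewrite permE val_to_fiber //; by case: (transitionP CD (pi_val v)).
Qed.

Lemma transition_perm_aut C D : edge C D -> forall u v : F,
  edge (transition_perm C D u) (transition_perm C D v) = edge u v.
Proof.
move=> CD u v; rewrite [LHS]visE [RHS]visE !val_transition_perm //.
by rewrite transition_slope ?pi_val.
Qed.

Lemma transition_perm_inv C D : edge C D ->
  transition_perm D C = ((transition_perm C D)^-1)%g.
Proof.
move=> CD; have DC : edge D C by rewrite edge_sym.
apply/permP => u; apply: (@perm_inj _ (transition_perm C D)); rewrite permKV.
apply: val_inj; rewrite !val_transition_perm //.
by have [] := transitionP DC (pi_val u).
Qed.

Definition quotient_bundle : bundle_data (Gquot R G) F :=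
  BundleData transition_perm_aut transition_perm_inv.

Definition trivialize x : bundle quotient_bundle :=
  (proj x, to_fiber ((chart (proj x)).2 x)).

Lemma val_trivialize x : val (trivialize x).2 = (chart (proj x)).2 x.
Proof.
apply: val_to_fiber; have [] // := @chart2P (proj x) x.
by rewrite label_proj.
Qed.

Lemma trivialize_bij : bijective trivialize.
Proof.
exists (fun p : bundle quotient_bundle => (chart p.1).1 (val p.2)) => [x|[C u]].
  rewrite val_trivialize; have [] // := @chart2P (proj x) x.
  by rewrite label_proj.
have [pt tK] := chart1P C (pi_val u).
have pC : proj ((chart C).1 (val u)) = C by apply: label_inj; rewrite label_proj.
rewrite /trivialize /= pC tK; congr (_, _); apply: val_inj.
by rewrite val_to_fiber ?pi_val.
Qed.

(** Between different sheets [hat_edge] keeps every edge, and the only candidate for a neighbor of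
    [x] in the sheet of [y] is its hop, which the transition encodes. Within a sheet it keeps
    exactly the visible edges, that is, the slopes, and charts preserve slopes. *)
Lemma trivialize_edge x y :
  edge (trivialize x) (trivialize y) = @edge (Ghat R G) x y.
Proof.
change (bundle_edge quotient_bundle (trivialize x) (trivialize y)
  = hat_edge R x y).
rewrite /bundle_edge /hat_edge connect_Gvis /= proj_eq.
have [eq_pi|/eqP neq] := eqVneq (pi x) (pi y); last first.
  rewrite andbF andbT orbF.
  apply/andP/idP => [[xy /eqP eq_t]|xy].
    have [xh ph] := quot_hop xy (esym (label_proj x)).
    suff -> : y = hop (@edge G) pi (label (proj y)) x by [].
    have px : pi x = label (proj x) by rewrite label_proj.
    have py : pi y = label (proj y) by rewrite label_proj.
    have := congr1 val eq_t; rewrite val_transition_perm // !val_trivialize.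
    rewrite /transition (chart2P px).2 => eq2.
    by rewrite -[LHS](chart2P py).2 eq2; exact: (chart2P ph).2.
  have exy := edge_proj xy neq; split=> //; apply/eqP/val_inj.
  rewrite val_transition_perm // !val_trivialize /transition.
  rewrite (@chart2P (proj x) x _).2 ?label_proj // hop_edge //.
have /eqP pxy : proj x == proj y by rewrite proj_eq eq_pi.
have px : pi x = label (proj y) by rewrite label_proj.
have py : pi y = label (proj y) by rewrite label_proj.
rewrite pxy quot_edge_irrefl andbT /= [LHS]visE !val_to_fiber //; last 2 first.
- exact: (chart2P py).1.
- exact: (chart2P px).1.
rewrite (sheet_iso_slope (sheet_iso_sym (chartP _)) px py) -visE /collapsed.
by rewrite /visible; case: edge => //=; case: asboolP.
Qed.

(** Charts and hops send peaks to peaks, so the transitions fix the peak of [H]. *)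
Lemma quotient_bundle_section :
  is_section (fun C => (C, fiber_peak) : bundle quotient_bundle).
Proof.
split=> // C D CD; apply/orP; left; apply/andP; split; first exact: CD.
by apply/eqP/val_inj; rewrite val_transition_perm //= transition_peak.
Qed.

End Trivialization.

End Quotient.

Theorem theorem1p7 (R : realType) (G : sgraph)
  (hconn : graph_connected G) (hsharp : lichnerowicz_sharp R G)
  (H : {set Gvis R G}) (hH : H \in components (Gvis R G)) :
  (exists s : bundle_data (Gquot R G) (induced H),
      graph_iso (Ghat R G) (bundle s) /\
      exists t : Gquot R G -> bundle s, is_section t) /\
  (#|Gquot R G| <> 1%N ->
      CD (Gquot R G) (2 : R) /\ 2 < lambda R (Gquot R G) 1).
Proof.
have [_ [cd _ _]] := sharp_eigenfunction hsharp.
have [f Ef visE] := exists_generic R G.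
have bal := sharp_balanced cd ((E2_eigenfunction f).1 Ef).
have [pi piP] := exists_summit_map (@edge G) f.
have [x HE] := componentsP bal piP visE _ hH.
(* [H] is taken as the base component of the charts, so that the model fiber is [induced H]. *)
have HE' : H = fiber pi (label bal piP visE (proj bal piP visE x)).
  by rewrite label_proj.
split=> [|n1]; last first.
  split; first exact: (CD_Gquot bal piP visE cd).
  exact: (lambda1_Gquot hconn bal piP visE cd n1).
exists (quotient_bundle hconn HE'); split.
  exists (trivialize hconn HE'); split; first exact: (trivialize_bij hconn HE').
  exact: (trivialize_edge hconn HE').
by eexists; exact: (quotient_bundle_section hconn HE').
Qed.
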